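(* Let $\ell\in\frac12\mathbb{N}$ and $\nu>0$, and let $W^{(\nu)}$ be the matrix-valued Gegenbauer weight defined in the context. The commutant algebra $$A^{(\nu)}=\{T\in M_{2\ell+1}(\mathbb{C})\mid [T,W^{(\nu)}(x)]=0\ \ \forall x\in(-1,1)\}$$ is generated (as an algebra) by $J$, where $J\in M_{2\ell+1}(\mathbb{C})$ is the self-adjoint involution defined by $J\colon e_j\mapsto e_{2\ell-j}$, $j=0,1,\dots,2\ell$.
   Context: $\{e_0,\dots,e_{2\ell}\}$ is the standard orthonormal basis of $\mathbb{C}^{2\ell+1}$ and matrices are indexed by $\{0,1,\dots,2\ell\}$; $[A,B]=AB-BA$; $\mathbb{N}=\{0,1,2,\dots\}$; $(a)_0=1$, $(a)_n=a(a+1)\cdots(a+n-1)$. The Gegenbauer polynomials are $C^{(\nu)}_n(x)=\frac{(2\nu)_n}{n!}\,{}_2F_1\!\left(-n,\,n+2\nu;\,\nu+\tfrac12;\,\tfrac12(1-x)\right)$. Definition of the weight. For $x\in(-1,1)$ and $m,n\in\{0,\dots,2\ell\}$ with $n\ge m$, $$\bigl(W^{(\nu)}(x)\bigr)_{m,n}=(1-x^2)^{\nu-1/2}\sum_{t=\max(0,n+m-2\ell)}^{m}\alpha^{(\nu)}_t(m,n)\,C^{(\nu)}_{m+n-2t}(x),$$ $$\alpha^{(\nu)}_t(m,n)=(-1)^m\frac{n!\,m!\,(m+n-2t)!}{t!\,(2\nu)_{m+n-2t}\,(\nu)_{n+m-t}}\,\frac{(\nu)_{n-t}(\nu)_{m-t}}{(n-t)!\,(m-t)!}\,\frac{n+m-2t+\nu}{n+m-t+\nu}\,(2\ell-m)!\,(n-2\ell)_{m-t}\,(-2\ell-\nu)_t\,\frac{2\ell+\nu}{(2\ell)!},$$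 and $W^{(\nu)}(x)$ is extended to a symmetric matrix. *)

(* Defs.v *)
From mathcomp Require Import all_boot all_order all_algebra.
From mathcomp Require Import falgebra complex.
From mathcomp Require Import all_classical all_reals all_analysis.

Set Implicit Arguments.
Unset Strict Implicit.
Unset Printing Implicit Defensive.

Import Order.TTheory GRing.Theory Num.Theory.
Import numFieldNormedType.Exports.

Local Open Scope ring_scope.

(* Everywhere below, the natural number L stands for 2 * l, so that l ranges
   over the half-integers (1/2)N as L ranges over nat, and matrices of size
   2 * l + 1 are indexed by 'I_L.+1 = {0, ..., 2 * l}. *)

Definition pochhammer (R : realType) (a : R) (n : nat) : R :=
  \prod_(i < n) (a + i%:R).

(* The hypergeometric series, as the limit of its partial sums. It is only used
   with a = - n%:R, where its terms vanish from index n.+1 on. *)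
Definition hyp2F1 (R : realType) (a b c z : R) : R :=
  limn (series (fun k : nat =>
    pochhammer a k * pochhammer b k / (pochhammer c k * k`!%:R) * z ^+ k)).

Definition gegenbauer (R : realType) (nu : R) (n : nat) (x : R) : R :=
  pochhammer (2 * nu) n / n`!%:R *
  hyp2F1 (- n%:R) (n%:R + 2 * nu) (nu + 2^-1) (2^-1 * (1 - x)).

(* Only meaningful for m <= n <= L and n + m - L <= t <= m, so that no natural
   number subtraction below is truncated; the differences n - 2 * l and
   - 2 * l - nu, which are not natural numbers, are taken in R. *)
Definition weight_coef (R : realType) (L : nat) (nu : R) (t m n : nat) : R :=
  (-1) ^+ m
  * ((n`!%:R * m`!%:R * (m + n - 2 * t)`!%:R)
     / (t`!%:R * pochhammer (2 * nu) (m + n - 2 * t)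
        * pochhammer nu (n + m - t)))
  * ((pochhammer nu (n - t) * pochhammer nu (m - t))
     / ((n - t)`!%:R * (m - t)`!%:R))
  * (((n + m - 2 * t)%:R + nu) / ((n + m - t)%:R + nu))
  * (L - m)`!%:R
  * pochhammer (n%:R - L%:R) (m - t)
  * pochhammer (- L%:R - nu) t
  * ((L%:R + nu) / L`!%:R).

(* The lower summation bound max(0, n + m - 2 * l) is the truncated
   subtraction of natural numbers. *)
Definition weight_entry (R : realType) (L : nat) (nu : R) (m n : nat) (x : R)
    : R :=
  (1 - x ^+ 2) `^ (nu - 2^-1)
  * \sum_(n + m - L <= t < m.+1)
      weight_coef L nu t m n * gegenbauer nu (m + n - 2 * t) x.

(* The entries with m <= n are given by the formula and the others by
   symmetry. *)
Definition weight (R : realType) (L : nat) (nu : R) (x : R) : 'M[R[i]]_L.+1 :=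
  \matrix_(m, n) ((weight_entry L nu (minn m n) (maxn m n) x)%:C)%C.

Definition commutator (F : fieldType) (n : nat) (A B : 'M[F]_n) : 'M[F]_n :=
  A *m B - B *m A.

Definition commutant (R : realType) (L : nat) (nu : R) : set 'M[R[i]]_L.+1 :=
  [set T | forall x : R, -1 < x < 1 -> commutator T (weight L nu x) = 0]%classic.

Definition basis_vec (F : fieldType) (L : nat) (j : 'I_L.+1) : 'cV[F]_L.+1 :=
  delta_mx j 0.

(* Column j is e_(L - j). *)
Definition flip_mx (F : fieldType) (L : nat) : 'M[F]_L.+1 :=
  \matrix_(i, j) (i == rev_ord j)%:R.

(* L cannot be inferred when commutant is not applied to a matrix. *)
Arguments commutant {R} L nu _.

(* Main.v *)
(* The coefficients alpha_t(m,n) are positive, and they are symmetric under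
   (m, n) -> (2l - n, 2l - m), so J commutes with W. Conversely, C_k has degree
   k, so a matrix T commuting with W(x) for all x commutes with each coefficient
   W_k of C_k in W. The matrix W_0 is diagonal, and its entries at e_0 and e_2l
   are strictly larger than the others, so T e_0 = a e_0 + b e_2l. Hence
   S = T - a - b J kills e_0 and commutes with W_1, which is tridiagonal with zero
   diagonal and positive off-diagonal entries. As e_0 is cyclic for W_1, S = 0. *)

Require Import Defs.
From mathcomp Require Import all_boot all_order all_algebra.
From mathcomp Require Import falgebra complex.
From mathcomp Require Import all_classical all_reals all_analysis.
From mathcomp Require Import zify ring lra.

Import Order.TTheory GRing.Theory Num.Theory.
Import numFieldNormedType.Exports.

Local Open Scope ring_scope.

(** * Pochhammer symbols *)

Lemma pochhammerD (R : realType) (a : R) (m n : nat) :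
  pochhammer a (m + n) = pochhammer a m * pochhammer (a + m%:R) n.
Proof.
rewrite /pochhammer big_split_ord /=; congr (_ * _).
by apply: eq_bigr => i _; rewrite natrD addrA.
Qed.

Lemma pochhammerS (R : realType) (a : R) (n : nat) :
  pochhammer a n.+1 = pochhammer a n * (a + n%:R).
Proof. by rewrite /pochhammer big_ord_recr. Qed.

Lemma pochhammer_gt0 (R : realType) (a : R) (n : nat) :
  0 < a -> 0 < pochhammer a n.
Proof.
by move=> a_gt0; apply: prodr_gt0 => i _; rewrite ltr_wpDr ?ler0n.
Qed.

Lemma pochhammer1 (R : realType) (n : nat) : pochhammer (1 : R) n = n`!%:R.
Proof.
elim: n => [|n IHn]; first by rewrite /pochhammer big_ord0.
by rewrite pochhammerS IHn factS mulnC natrM nat1r.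
Qed.

Lemma pochhammerN (R : realType) (a : R) (n : nat) :
  pochhammer (- a) n = (-1) ^+ n * pochhammer (a - n%:R + 1) n.
Proof.
rewrite /pochhammer (reindex_inj rev_ord_inj) -[in (-1) ^+ _](card_ord n).
rewrite -prodrN; apply: eq_bigr => i _ /=.
by rewrite natrB ?ltn_ord // -natr1; ring.
Qed.

Lemma pochhammerN_nat (R : realType) (n k : nat) : (k <= n)%N ->
  pochhammer (- n%:R : R) k = (-1) ^+ k * (n`!%:R / (n - k)`!%:R).
Proof.
move=> lekn; rewrite pochhammerN; congr (_ * _).
have := pochhammerD R 1 (n - k) k; rewrite subnK // !pochhammer1 => ->.
rewrite mulrC mulKf ?pnatr_eq0 ?gtn_eqF ?fact_gt0 //.
by congr (pochhammer _ _); rewrite natrB //; ring.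
Qed.

Lemma pochhammerN_nat_eq0 (R : realType) (n k : nat) : (n < k)%N ->
  pochhammer (- n%:R : R) k = 0.
Proof.
by move=> ltnk; rewrite /pochhammer (bigD1 (Ordinal ltnk)) //= addNr mul0r.
Qed.

(** This turns the factor [(-2l - nu)_t] of the weight into a sign times a ratio of Pochhammer
    symbols with positive base. *)
Lemma pochhammerN_natr_ratio (R : realType) (a : R) (n k : nat) :
  0 < a -> (k <= n)%N ->
  pochhammer (- n%:R - a) k
  = (-1) ^+ k * (pochhammer a n.+1 / pochhammer a (n - k).+1).
Proof.
move=> a_gt0 lekn; rewrite -opprD pochhammerN; congr (_ * _).
have -> : n.+1 = ((n - k).+1 + k)%N by rewrite addSn subnK.
rewrite pochhammerD [RHS]mulrC mulKf ?gt_eqF ?pochhammer_gt0 //.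
by congr (pochhammer _ _); rewrite -natr1 natrB //; ring.
Qed.

(** * Positivity and flip symmetry of the coefficients *)

(* The three signs cancel, leaving a manifestly positive expression that is
   invariant under (m, n, t) |-> (L - n, L - m, t + L - m - n). *)
Lemma weight_coefE (R : realType) (L : nat) (nu : R) (t m n : nat) :
  0 < nu -> (t <= m)%N -> (m <= n)%N -> (n <= L)%N -> (n + m - L <= t)%N ->
  weight_coef L nu t m n =
  (n`!%:R * m`!%:R * (L - m)`!%:R * (L - n)`!%:R)
    / (t`!%:R * (L + t - (m + n))`!%:R)
  * ((m + n - 2 * t)`!%:R / pochhammer (2 * nu) (m + n - 2 * t))
  * ((pochhammer nu (n - t) * pochhammer nu (m - t))
     / ((n - t)`!%:R * (m - t)`!%:R))
  * ((m + n - 2 * t)%:R + nu)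
  * (pochhammer nu L.+1 * (L%:R + nu) / L`!%:R)
  / (pochhammer nu (m + n - t).+1 * pochhammer nu (L - t).+1).
Proof.
move=> nu_gt0 letm lemn lenL let'.
have fn0 k : k`!%:R != 0 :> R by rewrite pnatr_eq0 gtn_eqF ?fact_gt0.
have pn0 k : pochhammer nu k != 0 by rewrite gt_eqF ?pochhammer_gt0.
have p2n0 k : pochhammer (2 * nu) k != 0.
  by rewrite gt_eqF ?pochhammer_gt0 ?mulr_gt0 ?ltr0n.
rewrite /weight_coef.
rewrite -opprB -natrB // pochhammerN_nat; last by lia.
rewrite pochhammerN_natr_ratio //; last by lia.
have -> : (L - n - (m - t) = L + t - (m + n))%N by lia.
rewrite (addnC n m) (pochhammerS _ nu (m + n - t)).
have d0 : (m + n - t)%:R + nu != 0 by rewrite gt_eqF // ltr_wpDl ?ler0n.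
have -> : (-1) ^+ m = (-1) ^+ (m - t) * (-1) ^+ t :> R by rewrite -exprD subnK.
have e1 k : (-1) ^+ k * (-1) ^+ k = 1 :> R by rewrite -expr2 sqrr_sign.
have := e1 (m - t)%N; have := e1 t.
set s1 := (-1) ^+ (m - t); set s2 := (-1) ^+ t => s22 s11.
rewrite (addrC nu).
(* With both squares written out on the right, the identity holds for arbitrary [s1] and [s2], so
   [field] needs no sign relation. *)
have insert_signs (z : R) : z = s1 * s1 * (s2 * s2) * z.
  by rewrite s11 s22 !mul1r.
rewrite [RHS]insert_signs.
move: (fn0 t) (fn0 (L + t - (m + n))%N) (fn0 (n - t)%N) (fn0 (m - t)%N) (fn0 L).
move: (pn0 (m + n - t)%N) (pn0 (L - t).+1) (p2n0 (m + n - 2 * t)%N) d0.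
clear.
move: (t`!%:R : R) ((L + t - (m + n))`!%:R : R) ((n - t)`!%:R : R)
      ((m - t)`!%:R : R) (L`!%:R : R) (pochhammer _ (m + n - t))
      (pochhammer _ (L - t).+1) (pochhammer _ (m + n - 2 * t))
      ((m + n - t)%:R + nu) => *; field.
by do ?[apply/andP; split].
Qed.

Lemma weight_coef_gt0 (R : realType) (L : nat) (nu : R) (t m n : nat) :
  0 < nu -> (t <= m)%N -> (m <= n)%N -> (n <= L)%N -> (n + m - L <= t)%N ->
  0 < weight_coef L nu t m n.
Proof.
move=> nu_gt0 letm lemn lenL let'; rewrite weight_coefE //.
have f0 k : 0 < k`!%:R :> R by rewrite ltr0n fact_gt0.
have pn0 k : 0 < pochhammer nu k by rewrite pochhammer_gt0.
have p2n0 k : 0 < pochhammer (2 * nu) k.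
  by rewrite pochhammer_gt0 ?mulr_gt0 ?ltr0n.
have a0 k : 0 < k%:R + nu by rewrite ltr_wpDl ?ler0n.
by do ![apply: mulr_gt0 => // | rewrite invr_gt0].
Qed.

Lemma weight_coef_flip (R : realType) (L : nat) (nu : R) (t m n : nat) :
  0 < nu -> (m <= n)%N -> (m + n <= L)%N -> (t <= m)%N ->
  weight_coef L nu (t + (L - (m + n))) (L - n) (L - m) = weight_coef L nu t m n.
Proof.
move=> nu_gt0 lemn lemnL letm; rewrite !weight_coefE //; try lia.
have -> : (L - (L - n) = n)%N by lia.
have -> : (L - (L - m) = m)%N by lia.
have -> : (L + (t + (L - (m + n))) - (L - n + (L - m)) = t + 0)%N by lia.
have -> : (L - n + (L - m) - 2 * (t + (L - (m + n))) = m + n - 2 * t)%N by lia.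
have -> : (L - m - (t + (L - (m + n))) = n - t)%N by lia.
have -> : (L - n - (t + (L - (m + n))) = m - t)%N by lia.
have -> : (L - n + (L - m) - (t + (L - (m + n))) = L - t)%N by lia.
have -> : (L - (t + (L - (m + n))) = m + n - t)%N by lia.
have -> : (L + t - (m + n) = t + (L - (m + n)))%N by lia.
rewrite addn0 (mulrC (t`!%:R : R)) (mulrC (pochhammer nu (L - t).+1)).
congr (_ / _ * _ * _ * _ * _ / _).
by rewrite [_ * m`!%:R]mulrC; ring.
Qed.

Lemma weight_entry_flip (R : realType) (L : nat) (nu : R) (m n : nat) (x : R) :
  0 < nu -> (m <= n)%N -> (n <= L)%N ->
  weight_entry L nu (L - n) (L - m) x = weight_entry L nu m n x.
Proof.
move=> nu_gt0.
(* The involution [(m, n) -> (L - n, L - m)] exchanges [m + n <= L] and [m + n >= L]. In the first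
   case the sum for [(m, n)] starts at [0], and the flipped one is its shift by [L - (m + n)]. *)
wlog lemnL : m n / (m + n <= L)%N => [hwlog|] lemn lenL.
  have [|ltLmn] := leqP (m + n) L; first by move=> ?; apply: hwlog.
  have := hwlog (L - n)%N (L - m)%N; rewrite !subKn //; last by lia.
  by move=> <- //; lia.
rewrite /weight_entry; congr (_ * _).
have -> : (L - m + (L - n) - L = 0 + (L - (m + n)))%N by lia.
rewrite big_addn.
have -> : ((L - n).+1 - (L - (m + n)) = m.+1)%N by lia.
have -> : (n + m - L = 0)%N by lia.
apply: eq_big_nat => t /andP[_ ltt]; rewrite weight_coef_flip //.
by congr (_ * gegenbauer _ _ _); lia.
Qed.

(** * Gegenbauer polynomials and polynomial identities on [(-1, 1)] *)

Definition gegenbauer_poly (R : realType) (nu : R) (n : nat) : {poly R} :=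
  (pochhammer (2 * nu) n / n`!%:R) *:
  (\poly_(k < n.+1) (pochhammer (- n%:R) k * pochhammer (n%:R + 2 * nu) k
                       / (pochhammer (nu + 2^-1) k * k`!%:R))
     \Po (2^-1 *: (1 - 'X))).

Lemma gegenbauerE (R : realType) (nu : R) (n : nat) (x : R) :
  gegenbauer nu n x = (gegenbauer_poly _ nu n).[x].
Proof.
rewrite /gegenbauer /gegenbauer_poly hornerZ horner_comp !hornerE horner_poly.
congr (_ * _).
rewrite /hyp2F1; apply: cvg_lim; first exact: Rhausdorff.
(* The partial sums are constant from [n.+1] on, because [(-n)_k = 0] for [k > n]. *)
apply: cvg_near_cst.
exists n.+1 => // N /= leN.
rewrite seriesEnat /= (big_cat_nat (n := n.+1)) //= big_mkord.
rewrite [X in _ + X]big_nat_cond [X in _ + X]big1 ?addr0 // => k.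
by rewrite andbT => /andP[ltnk _]; rewrite pochhammerN_nat_eq0 ?mul0r.
Qed.

(** The top coefficient contains [(-n)_n], which is nonzero, the other factors are nonzero since
    [nu > 0], and substituting the affine polynomial [(1 - X) / 2] preserves the degree. *)
Lemma size_gegenbauer_poly (R : realType) (nu : R) (n : nat) :
  0 < nu -> size (gegenbauer_poly _ nu n) = n.+1.
Proof.
move=> nu_gt0.
have fact_neq0 k : k`!%:R != 0 :> R by rewrite pnatr_eq0 -lt0n fact_gt0.
have poch_neq0 (a : R) k : 0 < a -> pochhammer a k != 0.
  by move=> a_gt0; rewrite gt_eqF ?pochhammer_gt0.
have nu2_gt0 : 0 < 2 * nu by rewrite mulr_gt0 ?ltr0n.
have nuh_gt0 : 0 < nu + 2^-1 by rewrite addr_gt0 ?invr_gt0 ?ltr0n.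
have nnu_gt0 : 0 < n%:R + 2 * nu by rewrite ltr_wpDl ?ler0n.
rewrite size_scale; last by rewrite mulf_neq0 ?invr_eq0 ?poch_neq0.
rewrite size_comp_poly2; last first.
  by rewrite size_scale ?invr_eq0 ?pnatr_eq0 // -opprB size_polyN size_XsubC.
apply: size_poly_eq => /=; rewrite pochhammerN_nat //.
by do ![apply: mulf_neq0 | rewrite invr_eq0 | rewrite signr_eq0
       | exact: fact_neq0 | apply: poch_neq0].
Qed.

(** Only the last polynomial reaches the top degree, so its coefficient vanishes and induction
    removes the others. *)
Lemma lin_indep_size_poly (F : idomainType) (p : nat -> {poly F}) (N : nat)
    (c : 'I_N -> F) :
  (forall k, size (p k) = k.+1) -> \sum_(k < N) c k *: p k = 0 ->
  forall k, c k = 0.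
Proof.
move=> szp; elim: N c => [|N IHN] c; first by move=> _ [].
rewrite big_ord_recr /= => sum0.
have cN0 : c ord_max = 0.
  have := congr1 (fun q : {poly F} => q`_N) sum0.
  rewrite /= coefD coef_sum big1 ?add0r => [|i _]; last first.
    by rewrite coefZ nth_default ?mulr0 // szp ltn_ord.
  have -> : (c ord_max *: p N)`_N = c ord_max * lead_coef (p N).
    by rewrite coefZ lead_coefE szp.
  rewrite coef0 => /eqP; rewrite mulf_eq0 lead_coef_eq0 -size_poly_eq0 szp orbF.
  by move/eqP.
rewrite cN0 scale0r addr0 in sum0 => k.
have [j ->|->] := unliftP ord_max k; last exact: cN0.
rewrite -(IHN (fun i => c (widen_ord (leqnSn N) i)) sum0 j).
by congr c; apply: val_inj; rewrite /= /bump leqNgt ltn_ord.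
Qed.

Lemma poly_eq0_itv (R : realType) (q : {poly R[i]}) :
  (forall x : R, -1 < x < 1 -> q.[(x%:C)%C] = 0) -> q = 0.
Proof.
move=> q0.
(* The points [1 / (k + 2)] are distinct and lie in [(-1, 1)]; [size q] of them are too many roots
   for a nonzero [q]. *)
pose r (k : nat) : R := k.+2%:R^-1.
apply: (@roots_geq_poly_eq0 _ _ [seq ((r k)%:C)%C | k <- iota 0 (size q)]).
- apply/allP => z /mapP[k _ ->]; apply/rootP/q0/andP; split.
    by rewrite (lt_trans (y := 0)) ?ltrN10 // invr_gt0 ltr0n.
  by rewrite invf_lt1 ?ltr1n ?ltr0n.
- rewrite map_inj_uniq ?iota_uniq // => j k /complexI /invr_inj /eqP.
  by rewrite eqr_nat => /eqP[].
- by rewrite size_map size_iota.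
Qed.

(** * Expansion of the weight in Gegenbauer polynomials *)

(* The coefficient of C_k^(nu) in W^(nu), without the scalar weight. *)
Definition weight_coef_mx (R : realType) (L : nat) (nu : R) (k : nat)
    : 'M[R[i]]_L.+1 :=
  \matrix_(i, j)
    ((\sum_(minn i j + maxn i j - L <= t < (minn i j).+1
           | (minn i j + maxn i j - 2 * t == k)%N)
       weight_coef L nu t (minn i j) (maxn i j))%:C)%C.

Lemma weightE (R : realType) (L : nat) (nu x : R) :
  weight L nu x = (((1 - x ^+ 2) `^ (nu - 2^-1))%:C)%C *:
    \sum_(k < (2 * L).+1) ((gegenbauer nu k x)%:C)%C *: weight_coef_mx _ L nu k.
Proof.
apply/matrixP => i j; rewrite !mxE summxE /weight_entry rmorphM; congr (_ * _).
transitivity (\sum_(k < (2 * L).+1) (((gegenbauer nu k x) *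
  \sum_(minn i j + maxn i j - L <= t < (minn i j).+1
           | (minn i j + maxn i j - 2 * t == k)%N)
       weight_coef L nu t (minn i j) (maxn i j))%:C)%C); last first.
  by apply: eq_bigr => k _; rewrite !mxE rmorphM.
rewrite -rmorph_sum; congr (_%:C)%C.
rewrite (addnC (maxn i j)).
(* The terms are grouped by degree; [inord] loses nothing, since the degree is at most [2 * L]. *)
pose deg t : 'I_(2 * L).+1 := inord (minn i j + maxn i j - 2 * t).
rewrite (partition_big deg xpredT) //=.
apply: eq_bigr => k _; rewrite big_distrr /=.
rewrite [LHS]big_mkcond [RHS]big_mkcond /=; apply: eq_bigr => t _.
have ltL : (minn i j + maxn i j - 2 * t < (2 * L).+1)%N.
  by have := ltn_ord i; have := ltn_ord j; lia.
rewrite -val_eqE /= inordK //.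
by case: eqP => // <-; rewrite mulrC.
Qed.

(** Up to the nonzero scalar weight, each entry of [[T, W(x)]] is a combination of the [C_k], whose
    coefficients are the entries of [[T, W_k]]. It vanishes on [(-1, 1)], hence as a polynomial, and
    the [C_k] are independent. *)
Lemma weight_coef_mx_comm (R : realType) (L : nat) (nu : R) (T : 'M[R[i]]_L.+1)
    (k : nat) : 0 < nu -> (k <= 2 * L)%N ->
  commutant L nu T ->
  T *m weight_coef_mx _ L nu k = weight_coef_mx _ L nu k *m T.
Proof.
move=> nu_gt0 lek /= commT; apply/matrixP => i j; apply/eqP; rewrite -subr_eq0.
pose c k := commutator T (weight_coef_mx _ L nu k) i j.
pose p k := map_poly (real_complex R) (gegenbauer_poly _ nu k).
suff c0 : forall k : 'I_(2 * L).+1, c k = 0.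
  by have := c0 (Ordinal (lek : (k < (2 * L).+1)%N)); rewrite /c !mxE => ->.
apply: (@lin_indep_size_poly _ p).
  by move=> n; rewrite size_map_poly size_gegenbauer_poly.
apply: poly_eq0_itv => x xI; rewrite horner_sum.
have := congr1 (fun M : 'M[R[i]]_L.+1 => M i j) (commT x xI).
rewrite /commutator weightE -scalemxAr -scalemxAl -scalerBr mulmx_sumr mulmx_suml.
rewrite -sumrB [LHS]mxE mxE => /eqP; rewrite mulf_eq0 => /orP[|/eqP sum0].
  move=> /eqP/(congr1 (@complex.Re R)) /= /eqP.
  rewrite gt_eqF // powR_gt0 // subr_gt0.
  by have /andP[? ?] := xI; nra.
rewrite -[RHS]sum0 summxE; apply: eq_bigr => n _; rewrite hornerZ horner_map.
by rewrite -gegenbauerE -scalemxAr -scalemxAl -scalerBr mxE mulrC.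
Qed.

(** * The matrices [W_0] and [W_1] *)

(** The degree is [(m - t) + (n - t)] with [t <= m <= n]; if it is at most [1], then [t = m] and
    [n = m + k]. *)
Lemma weight_coef_mx_le1E (R : realType) (L : nat) (nu : R) (k : nat)
    (i j : 'I_L.+1) : (k <= 1)%N ->
  weight_coef_mx _ L nu k i j =
  (if maxn i j == (minn i j + k)%N
   then ((weight_coef L nu (minn i j) (minn i j) (maxn i j))%:C)%C else 0).
Proof.
move=> lek1; rewrite mxE.
have lti := ltn_ord i; have ltj := ltn_ord j.
rewrite big_mkcond big_nat_recr /=; last by lia.
rewrite big_nat_cond big1 ?add0r => [|t]; last first.
  by rewrite andbT => ltt; case: eqP => //; lia.
have -> : (minn i j + maxn i j - 2 * minn i j == k)%N
          = (maxn i j == minn i j + k)%N by lia.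
by case: ifP.
Qed.

(** The function [f k = k! / (nu)_(k+1)] is the Beta value [B(k + 1, nu)]. Its successive ratios
    [(k + 1) / (nu + k + 1)] increase strictly, which gives
    [f (i + 1) * f j < f (i + 1 + j) * f 0]. *)
Lemma fact_pochhammer_lt (R : realType) (nu : R) (i j : nat) :
  0 < nu -> (0 < j)%N ->
  i.+1`!%:R / pochhammer nu i.+2 * (j`!%:R / pochhammer nu j.+1)
  < (i.+1 + j)`!%:R / pochhammer nu (i.+1 + j).+1 / pochhammer nu 1.
Proof.
move=> nu_gt0 j_gt0.
have f_gt0 k : 0 < k`!%:R :> R by rewrite ltr0n fact_gt0.
have p_gt0 k : 0 < pochhammer nu k by rewrite pochhammer_gt0.
pose f k : R := k`!%:R / pochhammer nu k.+1.
have f_pos k : 0 < f k by rewrite divr_gt0.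
have fS k : f k.+1 = f k * (k.+1%:R / (nu + k.+1%:R)).
  rewrite /f factS natrM (pochhammerS _ nu k.+1) invfM.
  have nuk_neq0 : nu + k.+1%:R != 0 by rewrite gt_eqF // addr_gt0 ?ltr0n.
  have := lt0r_neq0 (p_gt0 k.+1); move: nuk_neq0.
  move: (k.+1%:R : R) (k`!%:R : R) (pochhammer nu k.+1) => *; field.
  by apply/andP; split.
have ratio_lt k : k.+1%:R / (nu + k.+1%:R) < (k.+1 + j)%:R / (nu + (k.+1 + j)%:R).
  have nuk l : 0 < nu + l%:R by rewrite ltr_wpDr ?ler0n.
  rewrite ltr_pdivrMr // mulrAC ltr_pdivlMr // natrD.
  have : 0 < j%:R * nu by rewrite mulr_gt0 ?ltr0n.
  by nra.
(* The induction carries the weak inequality, as there is equality at [k = 0]; each step makes it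
   strict. *)
have step k : f k * f j <= f (k + j)%N / pochhammer nu 1 ->
    f k.+1 * f j < f (k.+1 + j)%N / pochhammer nu 1.
  move=> le_k; rewrite addSn !fS -addSn mulrAC [ltRHS]mulrAC.
  apply: (@lt_le_trans _ _ (f k * f j * ((k.+1 + j)%:R / (nu + (k.+1 + j)%:R)))).
    by rewrite (ltr_pM2l (mulr_gt0 (f_pos k) (f_pos j))); apply: ratio_lt.
  by rewrite ler_wpM2r // divr_ge0 ?ler0n // addr_ge0 ?ler0n ?ltW.
suff le_k k : f k * f j <= f (k + j)%N / pochhammer nu 1 by apply: step.
elim: k => [|k IHk]; last exact/ltW/step.
by rewrite add0n /f fact0 div1r mulrC.
Qed.

(** The diagonal entry of [W_0] at [k] is a constant times [f k * f (L - k)], with [f] the Beta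
    values above. *)
Lemma weight_coef_diag_lt (R : realType) (L : nat) (nu : R) (i : nat) :
  0 < nu -> (0 < i < L)%N -> weight_coef L nu i i i < weight_coef L nu 0 0 0.
Proof.
move=> nu_gt0 /andP[i_gt0 ltiL].
have p_gt0 k : 0 < pochhammer nu k by rewrite pochhammer_gt0.
have diagE k : (k <= L)%N -> weight_coef L nu k k k =
    nu * (pochhammer nu L.+1 * (L%:R + nu) / L`!%:R)
    * (k`!%:R / pochhammer nu k.+1 * ((L - k)`!%:R / pochhammer nu (L - k).+1)).
  move=> lekL; rewrite weight_coefE //; last by lia.
  have -> : (k + k - 2 * k = 0)%N by lia.
  have -> : (k + k - k = k)%N by lia.
  have -> : (L + k - (k + k) = L - k)%N by lia.
  rewrite subnn fact0 /pochhammer !big_ord0 -!/(pochhammer _ _) add0r invr1 !mulr1.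
  have f_neq0 l : l`!%:R != 0 :> R by rewrite pnatr_eq0 -lt0n fact_gt0.
  have p_neq0 l : pochhammer nu l != 0 by rewrite gt_eqF.
  move: (f_neq0 k) (f_neq0 (L - k)%N) (f_neq0 L) (p_neq0 k.+1) (p_neq0 (L - k).+1).
  move: (k`!%:R : R) ((L - k)`!%:R : R) (L`!%:R : R) (pochhammer _ k.+1)
        (pochhammer _ (L - k).+1) => *; field.
  by do ?[apply/andP; split].
rewrite !diagE //; last exact: ltnW.
rewrite ltr_pM2l; last first.
  by rewrite !mulr_gt0 ?invr_gt0 ?ltr0n ?fact_gt0 // ltr_wpDl ?ler0n.
have := @fact_pochhammer_lt _ nu i.-1 (L - i) nu_gt0.
rewrite subn_gt0 prednK // subnKC ?(ltnW ltiL) // => /(_ ltiL) /lt_le_trans; apply.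
by rewrite subn0 fact0 div1r mulrC.
Qed.

(** * Cyclic vectors and the flip matrix *)

(* The first basis vector is cyclic for an unreduced upper Hessenberg matrix. *)
Lemma comm_hessenberg_eq0 (F : fieldType) (n : nat) (S M : 'M[F]_n.+1) :
  (forall i j : 'I_n.+1, (j.+1 < i)%N -> M i j = 0) ->
  (forall i j : 'I_n.+1, i = j.+1 :> nat -> M i j != 0) ->
  S *m M = M *m S -> (forall i, S i ord0 = 0) -> S = 0.
Proof.
move=> M0 M1 SM S0.
suff S_eq0 k : forall i j : 'I_n.+1, (j <= k)%N -> S i j = 0.
  by apply/matrixP => i j; rewrite mxE (S_eq0 j).
elim: k => [|k IHk] i j.
  by rewrite leqn0 => /eqP j0; rewrite -(S0 i); congr (S _ _); apply: val_inj.
rewrite leq_eqVlt ltnS => /orP[/eqP jk|]; last exact: IHk.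
have ltk : (k < n.+1)%N by have := ltn_ord j; rewrite jk; apply: ltnW.
(* In column [k] of [S M = M S] the right side vanishes by induction. On the left, [S] kills the
   terms with [l <= k] and [M] those with [l > k + 1], leaving [S i j * M j k] with [j = k + 1]. *)
have := congr1 (fun A : 'M[F]_(n.+1) => A i (Ordinal ltk)) SM.
rewrite !mxE [RHS]big1 => [|l _]; last by rewrite IHk ?mulr0.
rewrite (bigD1 j) //= big1 ?addr0 => [|l neq_lj].
  by move/eqP; rewrite mulf_eq0 (negPf (M1 _ _ _)) ?jk // orbF => /eqP.
have [lek|ltk'] := leqP l k; first by rewrite IHk ?mul0r.
rewrite M0 ?mulr0 //= ltn_neqAle ltk' andbT -jk eq_sym.
exact: contra neq_lj.
Qed.

Lemma mul_flip_mx (F : fieldType) (L : nat) (A : 'M[F]_L.+1) (i j : 'I_L.+1) :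
  (flip_mx F L *m A) i j = A (rev_ord i) j.
Proof.
rewrite mxE (bigD1 (rev_ord i)) //= mxE rev_ordK eqxx mul1r big1 ?addr0 //.
move=> k neq_k; rewrite mxE -[i == _](inj_eq rev_ord_inj) rev_ordK eq_sym.
by rewrite (negPf neq_k) mul0r.
Qed.

Lemma mul_mx_flip (F : fieldType) (L : nat) (A : 'M[F]_L.+1) (i j : 'I_L.+1) :
  (A *m flip_mx F L) i j = A i (rev_ord j).
Proof.
rewrite mxE (bigD1 (rev_ord j)) //= mxE eqxx mulr1 big1 ?addr0 //.
by move=> k /negPf neq_k; rewrite mxE neq_k mulr0.
Qed.

Lemma flip_mx_comm_weight (R : realType) (L : nat) (nu x : R) : 0 < nu ->
  flip_mx R[i] L *m weight L nu x = weight L nu x *m flip_mx R[i] L.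
Proof.
move=> nu_gt0; apply/matrixP => i j; rewrite mul_flip_mx mul_mx_flip !mxE.
have lti := ltn_ord i; have ltj := ltn_ord j.
(* Flipping the sorted pair of [i] and [L - j] gives the sorted pair of [L - i] and [j]. *)
rewrite -[RHS](congr1 _ (weight_entry_flip _ _ _ _ _ _ nu_gt0 _ _)) /=; try lia.
by congr ((weight_entry _ _ _ _ _)%:C)%C; lia.
Qed.

Lemma commutant_flip_mx (R : realType) (L : nat) (nu : R) : 0 < nu ->
  commutant L nu (flip_mx R[i] L).
Proof.
by move=> nu_gt0 x _; rewrite /commutator flip_mx_comm_weight // subrr.
Qed.

(** * Determination of the commutant *)

Lemma commutant_scalar_flip (R : realType) (L : nat) (nu : R)
    (T : 'M[R[i]]_L.+1) : 0 < nu -> commutant L nu T ->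
  exists a b, T = a *: 1%:M + b *: flip_mx R[i] L.
Proof.
move=> nu_gt0 commT.
(* Entry [(i, 0)] of [T W_0 = W_0 T] is [T i 0] times a difference of diagonal entries of [W_0],
   which is nonzero for interior [i]. *)
have T0 (i : 'I_L.+1) : (0 < i < L)%N -> T i ord0 = 0.
  move=> iL; have := weight_coef_mx_comm _ _ _ T 0 nu_gt0 (leq0n _) commT.
  move=> /(congr1 (fun A : 'M[R[i]]_(L.+1) => A i ord0)).
  rewrite !mxE (bigD1 ord0) //= [X in _ + X]big1 => [|k nk0]; last first.
    rewrite weight_coef_mx_le1E // ifF ?mulr0 //.
    by move: nk0; rewrite -val_eqE /= addn0 maxn0 minn0 => /negPf.
  rewrite [RHS](bigD1 i) //= [X in _ = _ + X]big1 => [|k nki]; last first.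
    rewrite weight_coef_mx_le1E // ifF ?mul0r //.
    by move: nki; rewrite -val_eqE /= addn0; lia.
  rewrite !weight_coef_mx_le1E //= !addn0 !maxnn !minnn !eqxx !addr0 mulrC.
  move/eqP; rewrite -subr_eq0 -mulrBl mulf_eq0 subr_eq0 => /orP[|/eqP //].
  by move=> /eqP/complexI/eqP; rewrite gt_eqF // weight_coef_diag_lt.
(* For [L = 0] the flip is the identity and [ord_max = ord0], so taking [T ord_max ord0] would count
   the same entry twice. *)
pose b : R[i] := if L == 0%N then 0 else T ord_max ord0.
exists (T ord0 ord0), b; apply/eqP; rewrite -subr_eq0; apply/eqP.
have W1_eq0 (i j : 'I_L.+1) : (j.+1 < i)%N -> weight_coef_mx _ L nu 1 i j = 0.
  by move=> ltji; rewrite weight_coef_mx_le1E // ifF //; lia.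
have W1_neq0 (i j : 'I_L.+1) : i = j.+1 :> nat ->
    weight_coef_mx _ L nu 1 i j != 0.
  move=> ij; have lti := ltn_ord i; rewrite weight_coef_mx_le1E // ifT; last by lia.
  rewrite -[0]/(real_complex R 0) (inj_eq (@complexI R)) gt_eqF //.
  by apply: weight_coef_gt0 => //; lia.
(* Commutation with [W_1] is available only when [1 <= 2 * L], so size one is treated directly. *)
have [L0|L_gt0] := posnP L.
  apply/matrixP => i j; rewrite !mxE /b (introT eqP L0) mul0r addr0.
  have ord00 (k : 'I_L.+1) : k = ord0 by apply: val_inj; have := ltn_ord k => /=; lia.
  by rewrite (ord00 i) (ord00 j) eqxx mulr1 subrr.
apply: comm_hessenberg_eq0 W1_eq0 W1_neq0 _ _.
  have lt12L : (1 <= 2 * L)%N by lia.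
  rewrite mulmxBl mulmxBr mulmxDl mulmxDr -!scalemxAl -!scalemxAr mul1mx mulmx1.
  by rewrite !(weight_coef_mx_comm _ _ _ _ _ nu_gt0 lt12L) //; exact: commutant_flip_mx.
move=> i; rewrite !mxE /b (gtn_eqF L_gt0).
have -> : (i == rev_ord ord0) = (i == L :> nat) by rewrite -val_eqE /= subn1.
have [->|i_neq0] := eqVneq i ord0.
  by rewrite (ltn_eqF L_gt0) mulr1 mulr0 addr0 subrr.
rewrite mulr0 add0r; have [iL|i_neqL] := eqVneq (i : nat) L.
  by rewrite mulr1 (_ : i = ord_max) ?subrr //; apply: val_inj.
rewrite mulr0 subr0 T0 // lt0n ltn_neqAle i_neqL -ltnS ltn_ord !andbT.
exact: i_neq0.
Qed.

Theorem proposition2p6 (R : realType) (L : nat) (nu : R) (hnu : 0 < nu) :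
  [/\ forall j : 'I_L.+1,
        flip_mx R[i] L *m basis_vec R[i] j = basis_vec R[i] (rev_ord j),
      (flip_mx R[i] L)^t*%sesqui = flip_mx R[i] L,
      flip_mx R[i] L *m flip_mx R[i] L = 1%:M
    & commutant L nu = [set T | T \in <<1; flip_mx R[i] L>>%VS]%classic].
Proof.
split.
- move=> j; apply/matrixP => i k; rewrite !mxE (bigD1 j) //= !mxE eqxx big1.
    by rewrite addr0; case: eqP; rewrite ?mul0r ?mul1r.
  by move=> l /negPf neq_lj; rewrite !mxE neq_lj mulr0.
- apply/matrixP => i j; rewrite !mxE rmorph_nat -(inj_eq rev_ord_inj) rev_ordK.
  by rewrite eq_sym.
- apply/matrixP => i j; rewrite mul_flip_mx !mxE.
  by rewrite (inj_eq rev_ord_inj).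
apply/seteqP; split => T /=.
  case/(commutant_scalar_flip _ _ _ _ hnu) => a [b ->].
  have subE := @sub_agenv _ _ (1 + <[flip_mx R[i] L]>)%VS.
  apply: rpredD; apply: rpredZ; apply: (subvP subE).
    exact/(subvP (addvSl _ _))/memv_line.
  exact/(subvP (addvSr _ _))/memv_line.
move=> Tin x xI; apply/eqP; rewrite subr_eq0; apply/eqP.
(* The centraliser of [W(x)] contains [1] and is stable under left multiplication by the generators,
   hence contains the algebra they generate. *)
have sub_cent : (<<1; flip_mx R[i] L>> <= 'C[weight L nu x])%VS.
  have sub1 : (1 <= 'C[weight L nu x])%VS by rewrite -memvE cent1v1.
  apply: agenv_sub_modl => //; apply: subv_trans (asubv 'C[weight L nu x]%AS).
  apply: prodvSl; rewrite subv_add sub1 -memvE.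
  exact/cent1vP/flip_mx_comm_weight.
exact/cent1vP/(subvP sub_cent).
Qed.
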